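(* Let $R$ be a finite set of admitted bids whose exchange problem satisfies the regularity assumption in the context, with optimal value $Q(R)$, perturbation function $V$ and set of exact shadow prices $\Lambda^\star$. Let $e=(a_e,c_e,\bar x_e)\notin R$ be a valid optional bid, with no fixed admission charge. Then $$Q(R\cup\{e\})=\inf_{0\le x\le\bar x_e}\{c_e x+V(a_e x)\}\le V(0)=Q(R).$$ If $\bar x_e>0$, the finite right directional derivative $V'(0;a_e)$ exists, and $$c_e+V'(0;a_e)<0,\qquad(\ast)$$ then $Q(R\cup\{e\})<Q(R)$. If moreover the support identity $$V'(0;a_e)=-\inf_{\lambda\in\Lambda^\star}\lambda^\top a_e$$ holds, then condition $(\ast)$ is equivalent to $$c_e-\inf_{\lambda\in\Lambda^\star}\lambda^\top a_e<0.$$ When $\Lambda^\star=\{\lambda^\star\}$ is a singleton, this last condition reduces to $c_e-\lambda^{\star\top}a_e<0$. When $\Lambda^\star$ is not a singleton, negativity of $c_e-\lambda^\top a_e$ at one arbitrary $\lambda\in\Lambda^\star$ is not sufficient: there are instances in which it holds for some $\lambda\in\Lambda^\star$ but $Q(R\cup\{e\})=Q(R)$.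
   Context: Let $\mathcal K$ be a finite set of commodities, and let $\mathcal M^0$ be a finite set of incumbent firms. Agent $0$ (recourse) has cost $\tilde F_0(q)=\Phi(q)$ if $q\in\mathbb R_+^{|\mathcal K|}$ and $+\infty$ otherwise, where $\Phi:\mathbb R_+^{|\mathcal K|}\to\mathbb R$ is finite, closed, convex and componentwise nondecreasing. Each firm $m\in\mathcal M^0$ has a closed, proper, convex cost function $\tilde F_m:\mathbb R^{|\mathcal K|}\to(-\infty,+\infty]$ of its net injection. A valid optional bid $e=(a_e,c_e,\bar x_e)$ has an injection vector $a_e\in\mathbb R_+^{|\mathcal K|}$ with nonempty support, a unit cost $c_e\ge0$ and a finite limit $\bar x_e>0$; if admitted it supplies $a_e x$ at cost $c_e x$ for any uptake $0\le x\le\bar x_e$ chosen by the exchange problem, i.e. as an agent it has cost $$\tilde F_e(q)=\inf_{0\le x\le\bar x_e}\{c_e x:q=a_e x\}$$ ($+\infty$ if no such $x$ exists). For a finite set $R$ of admitted bids, let $\mathcal I=\{0\}\cup\mathcal M^0\cup R$ and let $$Q(R)=\inf_{\{q_i\}}\Big\{\sum_{i\in\mathcal I}\tilde F_i(q_i):\sum_{i\in\mathcal I}q_i=0\Big\},\qquad V(b)=\inf_{\{q_i\}}\Big\{\sum_{i\in\mathcal I}\tilde F_i(q_i):\sum_{i\in\mathcal I}q_i+b=0\Big\}\quad(b\in\mathbb R^{|\mathcal K|}).$$ Regularity assumption for the agent set $\mathcal I$: every $\tilde F_i$ is closed, proper and convex, the problem defining $Q(R)$ is feasible with finite optimal value,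 and its Lagrangian $\sum_i\tilde F_i(q_i)+y^\top\sum_iq_i$ admits a saddle point. The set of exact shadow prices is $\Lambda^\star=\{-y: y\text{ is an optimal multiplier}\}$, where an optimal multiplier is the dual component of a saddle point. $V'(0;a)=\lim_{t\downarrow0}(V(ta)-V(0))/t$. *)

(* Defs.v *)
From HB Require Import structures.
From mathcomp Require Import all_boot all_order all_algebra.
From mathcomp Require Import finmap.
From mathcomp Require Import all_classical all_reals all_analysis.

Set Implicit Arguments.
Unset Strict Implicit.
Unset Printing Implicit Defensive.

Import Order.TTheory GRing.Theory Num.Theory.
Import numFieldNormedType.Exports.

Local Open Scope classical_set_scope.
Local Open Scope ring_scope.

(* Commodities are indexed by 'I_n, so R^K is 'rV[R]_n. *)

Definition dot (R : realType) (n : nat) (u v : 'rV[R]_n) : R :=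
  \sum_(k < n) u 0 k * v 0 k.

Definition nonnegv (R : realType) (n : nat) (q : 'rV[R]_n) : bool :=
  [forall k, 0 <= q 0 k].

Definition epigraph (R : realType) (n : nat) (f : 'rV[R]_n -> \bar R) :
    set ('rV[R]_n * R) :=
  [set p | (f p.1 <= p.2%:E)%E].

Definition closed_fun (R : realType) (n : nat) (f : 'rV[R]_n -> \bar R) : Prop :=
  closed (epigraph f).

(* The epigraph is seen in the R-module 'rV[R]_n * R^o. *)
Definition convex_fun (R : realType) (n : nat) (f : 'rV[R]_n -> \bar R) : Prop :=
  convex_set (epigraph f : set (convex_lmodType ('rV[R]_n * R^o)%type)).

Definition proper_fun (R : realType) (n : nat) (f : 'rV[R]_n -> \bar R) : Prop :=
  (forall q, f q != -oo%E) /\ (exists q, f q != +oo%E).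

Definition closed_proper_convex (R : realType) (n : nat)
    (f : 'rV[R]_n -> \bar R) : Prop :=
  [/\ closed_fun f, proper_fun f & convex_fun f].

(* [Phi] is only used on the nonnegative orthant.  [bid] is a type of names
   for the optional bids; the bid named e is the triple
   (bid_inj e, bid_rate e, bid_limit e), so distinct bids may carry the same
   data. *)
Record market (R : realType) (n : nat) := Market {
  Phi : 'rV[R]_n -> R;
  incumbent : finType;
  firm_cost : incumbent -> 'rV[R]_n -> \bar R;
  bid : choiceType;
  bid_inj : bid -> 'rV[R]_n;
  bid_rate : bid -> R;
  bid_limit : bid -> R
}.

Definition recourse_cost (R : realType) (n : nat) (M : market R n)
    (q : 'rV[R]_n) : \bar R :=
  if nonnegv q then (Phi M q)%:E else +oo%E.

(* Closedness of Phi, a function on the closed orthant, is closedness of its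
   epigraph, which is the epigraph of [recourse_cost M]. *)
Definition valid_market (R : realType) (n : nat) (M : market R n) : Prop :=
  [/\ closed_fun (recourse_cost M),
      @convex_function R 'rV[R]_n [set q | nonnegv q] (Phi M),
      (forall p q : 'rV[R]_n, nonnegv p -> nonnegv q ->
         (forall k, p 0 k <= q 0 k) -> Phi M p <= Phi M q) &
      (forall m : incumbent M, closed_proper_convex (firm_cost m))].

Definition valid_bid (R : realType) (n : nat) (M : market R n) (e : bid M) :
    Prop :=
  [/\ nonnegv (bid_inj e), (exists k, bid_inj e 0 k != 0), 0 <= bid_rate e
    & 0 < bid_limit e].

Definition bid_cost (R : realType) (n : nat) (M : market R n) (e : bid M)
    (q : 'rV[R]_n) : \bar R :=
  ereal_inf [set (bid_rate e * x)%:E | x in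
              [set x : R | 0 <= x <= bid_limit e /\ q = x *: bid_inj e]].

(* {0} + incumbents + admitted bids, with the recourse agent 0 as [None]. *)
Definition agent (R : realType) (n : nat) (M : market R n)
    (S : {fset bid M}) : finType :=
  option (incumbent M + S).

Definition cost (R : realType) (n : nat) (M : market R n) (S : {fset bid M})
    (i : agent S) : 'rV[R]_n -> \bar R :=
  match i with
  | None => recourse_cost M
  | Some (inl m) => firm_cost m
  | Some (inr e) => bid_cost (val e)
  end.

Definition total_cost (R : realType) (n : nat) (M : market R n)
    (S : {fset bid M}) (q : agent S -> 'rV[R]_n) : \bar R :=
  (\sum_(i : agent S) cost i (q i))%E.

Definition exchange_value (R : realType) (n : nat) (M : market R n)
    (S : {fset bid M}) : \bar R :=
  ereal_inf [set total_cost q | q in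
              [set q : agent S -> 'rV[R]_n | \sum_i q i = 0]].

Definition perturbed_value (R : realType) (n : nat) (M : market R n)
    (S : {fset bid M}) (b : 'rV[R]_n) : \bar R :=
  ereal_inf [set total_cost q | q in
              [set q : agent S -> 'rV[R]_n | \sum_i q i + b = 0]].

Definition Lagrangian (R : realType) (n : nat) (M : market R n)
    (S : {fset bid M}) (q : agent S -> 'rV[R]_n) (y : 'rV[R]_n) : \bar R :=
  (total_cost q + (dot y (\sum_i q i)%R)%:E)%E.

Definition saddle_point (R : realType) (n : nat) (M : market R n)
    (S : {fset bid M}) (q : agent S -> 'rV[R]_n) (y : 'rV[R]_n) : Prop :=
  (forall y', Lagrangian q y' <= Lagrangian q y)%E /\
  (forall q' : agent S -> 'rV[R]_n, Lagrangian q y <= Lagrangian q' y)%E.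

Definition optimal_multiplier (R : realType) (n : nat) (M : market R n)
    (S : {fset bid M}) (y : 'rV[R]_n) : Prop :=
  exists q : agent S -> 'rV[R]_n, saddle_point q y.

Definition shadow_prices (R : realType) (n : nat) (M : market R n)
    (S : {fset bid M}) : set 'rV[R]_n :=
  [set - y | y in [set y | optimal_multiplier S y]].

Definition feasible (R : realType) (n : nat) (M : market R n)
    (S : {fset bid M}) : Prop :=
  exists2 q : agent S -> 'rV[R]_n,
    \sum_i q i = 0 & (total_cost q < +oo)%E.

Definition regular (R : realType) (n : nat) (M : market R n)
    (S : {fset bid M}) : Prop :=
  [/\ forall i : agent S, closed_proper_convex (cost i),
      feasible S,
      exchange_value S \is a fin_num &
      exists (q : agent S -> 'rV[R]_n) (y : 'rV[R]_n), saddle_point q y].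

Definition diff_quotient (R : realType) (n : nat) (f : 'rV[R]_n -> \bar R)
    (a : 'rV[R]_n) (t : R) : \bar R :=
  ((f (t *: a)%R - f 0%R) * (t^-1)%:E)%E.

Definition dirderiv0 (R : realType) (n : nat) (f : 'rV[R]_n -> \bar R)
    (a : 'rV[R]_n) : \bar R :=
  lim (diff_quotient f a t @[t --> (0 : R)^'+]).

(* [lim] is a total operator: existence of the limit is stated separately. *)
Definition finite_dirderiv0 (R : realType) (n : nat) (f : 'rV[R]_n -> \bar R)
    (a : 'rV[R]_n) : Prop :=
  cvg (diff_quotient f a t @[t --> (0 : R)^'+]) /\
  dirderiv0 f a \is a fin_num.

Definition min_price (R : realType) (n : nat) (L : set 'rV[R]_n)
    (a : 'rV[R]_n) : \bar R :=
  ereal_inf [set (dot l a)%:E | l in L].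

Definition standing_assumptions (R : realType) (n : nat) (M : market R n)
    (S : {fset bid M}) (e : bid M) : Prop :=
  [/\ valid_market M, forall f, f \in S -> valid_bid f, regular S,
      valid_bid e & e \notin S].

(* Main.v *)
Require Import Defs.
From HB Require Import structures.
From mathcomp Require Import all_boot all_order all_algebra.
From mathcomp Require Import finmap.
From mathcomp Require Import all_classical all_reals all_analysis.
From mathcomp Require Import lra.

Set Implicit Arguments.
Unset Strict Implicit.
Unset Printing Implicit Defensive.

Import Order.TTheory GRing.Theory Num.Theory.
Import numFieldNormedType.Exports.

Local Open Scope classical_set_scope.
Local Open Scope ring_scope.
Local Open Scope ereal_scope.

(* An allocation that admits e is an uptake x of e, fixed by the injection of e
   since a_e <> 0, together with an allocation of the other agents perturbed by
   x a_e; a negative right derivative of x |-> c_e x + V(x a_e) at 0 then makes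
   some small uptake profitable.

   In the counterexample, one commodity, no admitted bids, recourse cost
   max(0, q - 1) and a firm demanding exactly one unit give V(b) = max(0, -b)
   for b <= 1, and every price in [0, 1] is a shadow price.  A bid with
   injection 1 and unit cost 1/2 beats the price 1, but V = 0 on [0, 1], so
   admitting it saves nothing. *)

(** * Agents before and after the admission of one bid *)

Section AdmitBid.
Context {R : realType} {n : nat} {M : market R n} (S : {fset bid M}).
Variable e : bid M.
Implicit Types (q : agent S -> 'rV[R]_n) (v : 'rV[R]_n).

Definition new_agent : agent (e |` S)%fset :=
  Some (inr [` fset1U1 e S]%fset).

Definition old_agent (i : agent S) : agent (e |` S)%fset :=
  match i with
  | None => None
  | Some (inl m) => Some (inl m)
  | Some (inr f) => Some (inr (fincl (fsubsetU1 e S) f))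
  end.

(** A partial inverse of [old_agent], undefined only at [new_agent] when [e] is outside [S]. Sums
    are reindexed through it. *)
Definition old_agentV (i : agent (e |` S)%fset) : option (agent S) :=
  match i with
  | None => Some None
  | Some (inl m) => Some (Some (inl m))
  | Some (inr f) => omap (fun g => Some (inr g)) (insub (val f))
  end.

Lemma old_agentK : pcancel old_agent old_agentV.
Proof.
case=> [[m|f]|]//=; rewrite insubT ?fsvalP//= => fS.
by congr (Some (Some (inr _))); exact: val_inj.
Qed.

Lemma old_agentVK i : i != new_agent -> omap old_agent (old_agentV i) = Some i.
Proof.
case: i => [[m|f]|]//= fe; have := fsvalP f; rewrite in_fset1U => /orP[/eqP fE|fS].
  by case/negP: fe; apply/eqP; congr (Some (inr _)); exact: val_inj.
by rewrite insubT//=; congr (Some (Some (inr _))); exact: val_inj.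
Qed.

Hypothesis eS : e \notin S.

Lemma old_agentV_new : old_agentV new_agent = None.
Proof. by rewrite /old_agentV/= insubN. Qed.

Lemma old_agent_neq i : old_agent i != new_agent.
Proof. by apply/eqP => /(congr1 old_agentV); rewrite old_agentK old_agentV_new. Qed.

(** Split off [new_agent], then reindex the rest along [old_agent]. The law is abstract because both
    injection vectors and extended-real costs get summed. *)
Lemma big_agent_fsetU1 (T : Type) (x0 : T) (op : Monoid.com_law x0)
    (F : agent (e |` S)%fset -> T) :
  \big[op/x0]_i F i = op (F new_agent) (\big[op/x0]_i F (old_agent i)).
Proof.
rewrite (bigD1 new_agent)//=; congr (op _ _).
rewrite (reindex_omap old_agent old_agentV); last exact: old_agentVK.
by apply: eq_bigl => i; rewrite old_agent_neq old_agentK eqxx.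
Qed.

Lemma cost_old_agent i : cost (old_agent i) = cost i.
Proof. by case: i => [[m|f]|]. Qed.

Lemma total_cost_fsetU1 (q : agent (e |` S)%fset -> 'rV[R]_n) :
  total_cost q = bid_cost e (q new_agent) + total_cost (q \o old_agent).
Proof.
rewrite /total_cost big_agent_fsetU1; congr (_ + _).
by apply: eq_bigr => i _; rewrite cost_old_agent.
Qed.

Definition extend_profile q v (i : agent (e |` S)%fset) : 'rV[R]_n :=
  if old_agentV i is Some j then q j else v.

Lemma extend_profile_old q v : extend_profile q v \o old_agent = q.
Proof. by apply/funext => i; rewrite /= /extend_profile old_agentK. Qed.

Lemma extend_profile_new q v : extend_profile q v new_agent = v.
Proof. by rewrite /extend_profile old_agentV_new. Qed.

End AdmitBid.

(** * The exchange value as an infimum over uptakes, and descent at zero uptake *)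

Section ExchangeValue.
Context {R : realType} {n : nat} {M : market R n}.
Implicit Types (S : {fset bid M}) (e : bid M).

(** A nonzero coordinate of the injection recovers [x] from [x *: bid_inj e], so the infimum runs
    over a single value. *)
Lemma bid_costZ e (x : R) : valid_bid e -> (0 <= x <= bid_limit e)%R ->
  bid_cost e (x *: bid_inj e) = (bid_rate e * x)%:E.
Proof.
case=> _ [k ak] _ _ xe; rewrite /bid_cost.
rewrite [X in ereal_inf X](_ : _ = [set (bid_rate e * x)%:E]) ?ereal_inf1//.
apply/seteqP; split => [_ [z [_ /rowP/(_ k) zx] <-]|_ ->]; last by exists x.
by move: zx; rewrite !mxE => /(mulIf ak) ->.
Qed.

Lemma bid_cost_infeasible e v :
  (forall x, (0 <= x <= bid_limit e)%R -> v <> x *: bid_inj e)%R ->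
  bid_cost e v = +oo.
Proof.
move=> ve; rewrite /bid_cost [X in ereal_inf X](_ : _ = set0) ?ereal_inf0//.
by rewrite -subset0 => w [x [xe vE] _]; exact: ve vE.
Qed.

Lemma perturbed_value0 S : perturbed_value S 0 = exchange_value S.
Proof.
rewrite /perturbed_value /exchange_value; congr (ereal_inf [set _ | _ in _]).
by apply/funext => q /=; rewrite addr0.
Qed.

(** As [+oo + -oo] is [-oo], this is what makes an unattainable injection of the new bid force an
    infinite total. *)
Lemma total_cost_neqNy S (q : agent S -> 'rV[R]_n) :
  (forall i : agent S, proper_fun (cost i)) -> total_cost q != -oo.
Proof.
move=> Sp; apply/eqP => /esum_eqNyP[i [_ _ qi]].
by have [/(_ (q i))/eqP] := Sp i.
Qed.

Lemma exchange_value_fsetU1 S e :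
  (forall i : agent S, proper_fun (cost i)) -> valid_bid e -> e \notin S ->
  exchange_value (e |` S)%fset =
    ereal_inf [set (bid_rate e * x)%:E + perturbed_value S (x *: bid_inj e)%R
              | x in [set x : R | (0 <= x <= bid_limit e)%R]].
Proof.
move=> Sp ve eS; apply/eqP; rewrite eq_le; apply/andP; split.
  (* The cost of the uptake is finite, so it can change sides; the bound is then checked on each
     allocation of the perturbed problem. *)
  apply/ereal_infP => _ [x xe <-]; rewrite addeC -leeBlDr//.
  apply/ereal_infP => _ [q qx <-]; rewrite leeBlDr// addeC.
  apply: ereal_inf_lbound; exists (extend_profile q (x *: bid_inj e)%R).
    rewrite /= big_agent_fsetU1//= extend_profile_new// addrC -[RHS]qx.
    by under eq_bigr do rewrite /extend_profile old_agentK.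
  by rewrite total_cost_fsetU1// extend_profile_old extend_profile_new// bid_costZ.
apply/ereal_infP => _ [q /= q0 <-]; rewrite total_cost_fsetU1//.
(* Either the injection of [e] comes from an admissible uptake, or it costs [+oo] and nothing is
   left to prove. *)
have [[x [xe qx]]|qx] := pselect (exists x,
    (0 <= x <= bid_limit e)%R /\ q (new_agent S e) = (x *: bid_inj e)%R).
  rewrite qx bid_costZ//.
  apply: (@le_trans _ _ ((bid_rate e * x)%:E +
      perturbed_value S (x *: bid_inj e)%R)).
    by apply: ereal_inf_lbound; exists x.
  rewrite leeD2l//; apply: ereal_inf_lbound; exists (q \o @old_agent _ _ _ S e) => //=.
  by rewrite addrC -qx -[RHS]q0 big_agent_fsetU1.
rewrite bid_cost_infeasible; last by move=> x xe qxE; apply: qx; exists x.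
by rewrite addye ?leey ?total_cost_neqNy.
Qed.

(** The quotient has a limit below [- c], so it stays below [- c] for all small [t > 0]; multiply by
    such a [t] less than [x]. *)
Lemma dirderiv0_lt S (a : 'rV[R]_n) (c x : R) :
  (0 < x)%R -> perturbed_value S 0%R \is a fin_num ->
  finite_dirderiv0 (perturbed_value S) a ->
  c%:E + dirderiv0 (perturbed_value S) a < 0 ->
  exists2 t : R, (0 <= t <= x)%R &
    (c * t)%:E + perturbed_value S (t *: a)%R < perturbed_value S 0%R.
Proof.
move=> x0 V0 [Vcvg Vfin] cV.
have {}cV : dirderiv0 (perturbed_value S) a < (- c)%:E.
  by move: cV; rewrite -(fineK Vfin) -EFinD !lte_fin => ?; lra.
have nt : \forall t \near (0 : R)^'+,
    diff_quotient (perturbed_value S) a t < (- c)%:E.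
  apply: (Vcvg [set y | y < (- c)%:E]).
  apply: open_nbhs_nbhs; split => //; exact: open_ereal_lt_ereal.
near (0%R : R)^'+ => t.
have t0 : (0 < t)%R by near: t; exact: nbhs_right_gt.
have tx : (t < x)%R by near: t; exact: nbhs_right_lt.
exists t; first by rewrite !ltW.
have : diff_quotient (perturbed_value S) a t < (- c)%:E by near: t.
rewrite /diff_quotient lte_pdivrMr// -EFinM lteBlDr// -(fineK V0).
(* The perturbed value may be infinite: [+oo] contradicts the bound on the quotient, and [-oo] makes
   the claim immediate. *)
case: (perturbed_value S (t *: a)%R) => [v| |]//=; rewrite ?ltNyr//.
by rewrite -!EFinD !lte_fin => ?; lra.
Unshelve. all: by end_near.
Qed.

End ExchangeValue.

(** * Half-spaces, the building blocks of polyhedral epigraphs *)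

Section Halfspaces.
Context {R : realType} {n : nat}.
Implicit Types (u v w : R) (k : 'I_n).

Definition halfspace k u v w : set ('rV[R]_n * R) :=
  [set p : 'rV[R]_n * R | (w <= u * p.1 0 k + v * p.2)%R].

Lemma closed_halfspace k u v w : closed (halfspace k u v w).
Proof.
rewrite (_ : halfspace _ _ _ _ = (fun p : 'rV[R]_n * R =>
  u * p.1 0 k + v * p.2)%R @^-1` [set x : R | (w <= x)%R])//.
apply: preimage_closed; last exact: closed_ge.
move=> p _; apply: cvgD; apply: cvgM; [exact: cvg_cst| |exact: cvg_cst|exact: cvg_snd].
apply: (@continuous_comp _ _ _ fst (fun q : 'rV[R]_n => q 0%R k)); first exact: cvg_fst.
exact: coord_continuous.
Qed.

Lemma convex_halfspace k u v w :
  convex_set (halfspace k u v w : set (convex_lmodType ('rV[R]_n * R^o)%type)).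
Proof.
move=> [p r] [q s] t; rewrite !inE /halfspace/= !mxE => pw qw.
have t0 : (0 <= t%:num)%R by [].
have t1 : (t%:num <= 1)%R by [].
(* The weight becomes a plain real variable, ready for [nra]. *)
move: (t%:num%R) t0 t1 => {}t t0 t1.
by rewrite /unstable.onem /GRing.scale/=; nra.
Qed.

Lemma convex_setI (E : lmodType R) (A B : set (convex_lmodType E)) :
  convex_set A -> convex_set B -> convex_set (A `&` B).
Proof.
move=> Ac Bc x y t; rewrite !in_setI => /andP[xA xB] /andP[yA yB].
by rewrite Ac ?Bc.
Qed.

End Halfspaces.

(** * The counterexample with a kinked recourse cost *)

Section KinkedMarket.
Context {R : realType}.
Implicit Types (q : 'rV[R]_1) (t x : R).

Definition kinked_cost q : R := Num.max 0%R (q 0 0 - 1)%R.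

(** Injections are net, so a demand of one unit is the point [-1]. *)
Definition unit_demand q : \bar R := if q 0%R 0%R == (- 1)%R then 0 else +oo.

Definition kinked_market : market R 1 := {|
  Phi := kinked_cost;
  incumbent := unit;
  firm_cost := fun=> unit_demand;
  bid := unit;
  bid_inj := fun=> const_mx 1%R;
  bid_rate := fun=> (2^-1)%R;
  bid_limit := fun=> 1%R
|}.

Local Notation no_bids := (fset0 : {fset bid kinked_market}).
Local Notation hspace u v w := (@halfspace R 1 0%R u%R v%R w%R).
Local Notation firm := (Some (inl tt)).

Lemma nonnegv1 q : nonnegv q = (0 <= q 0 0)%R.
Proof. by apply/forallP/idP => [/(_ 0%R)//|q0 k]; rewrite ord1. Qed.

Lemma dot1 (p q : 'rV[R]_1) : dot p q = (p 0 0 * q 0 0)%R.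
Proof. by rewrite /dot big_ord1. Qed.

Lemma recourse_cost_kinked q : recourse_cost kinked_market q =
  if (0 <= q 0 0)%R then (kinked_cost q)%:E else +oo.
Proof. by rewrite /recourse_cost nonnegv1. Qed.

Lemma cost_kinked_ge0 (S : {fset bid kinked_market}) (i : agent S) q :
  0 <= cost i q.
Proof.
case: i => [[m|f]|]/=.
- by rewrite /unit_demand; case: ifP.
- apply/ereal_infP => _ [x [/andP[x0 _] _] <-].
  by rewrite lee_fin mulr_ge0//= invr_ge0.
- rewrite recourse_cost_kinked; case: ifP => // _.
  by rewrite lee_fin le_max lexx.
Qed.

(** Gives the lower half of every exchange value computed below, with or without the bid. *)
Lemma kinked_total_ge0 (S : {fset bid kinked_market}) (q : agent S -> 'rV[R]_1) :
  0 <= total_cost q.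
Proof. by apply: sume_ge0 => i _; exact: cost_kinked_ge0. Qed.

Lemma closed_proper_convex_recourse :
  closed_proper_convex (recourse_cost kinked_market).
Proof.
(* The three half-spaces are [q >= 0], [r >= 0] and [r >= q - 1]. *)
have epiE : epigraph (recourse_cost kinked_market) =
    hspace 1 0 0 `&` (hspace 0 1 0 `&` hspace (-1) 1 (-1)).
  apply/seteqP; split => [[q r]|[q r] [q0 [r0 qr]]];
      rewrite /epigraph/= recourse_cost_kinked.
    case: ifP => [q0|_]; last by rewrite leNgt ltry.
    rewrite lee_fin /kinked_cost ge_max => /andP[r0 qr].
    by rewrite /halfspace; split; [|split] => /=; lra.
  move: q0 r0 qr; rewrite /halfspace/= => q0 r0 qr.
  by rewrite ifT; [rewrite lee_fin /kinked_cost ge_max; apply/andP; split|]; lra.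
split.
- rewrite /closed_fun epiE; apply: closedI; last apply: closedI;
    exact: closed_halfspace.
- split=> [q|]; first by rewrite recourse_cost_kinked; case: ifP.
  by exists 0%R; rewrite recourse_cost_kinked mxE lexx.
- rewrite /convex_fun epiE; apply: convex_setI; last apply: convex_setI;
    exact: convex_halfspace.
Qed.

Lemma closed_proper_convex_demand : closed_proper_convex unit_demand.
Proof.
(* The equation [q = -1] is written as two opposite inequalities. *)
have epiE : epigraph unit_demand =
    hspace 1 0 (-1) `&` (hspace (-1) 0 1 `&` hspace 0 1 0).
  apply/seteqP; split => [[q r]|[q r] [q1 [q2 r0]]];
      rewrite /epigraph/= /unit_demand.
    case: ifPn => [/eqP q1|_]; last by rewrite leNgt ltry.
    by rewrite lee_fin /halfspace/= q1 => r0; split; [|split] => /=; lra.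
  move: q1 q2 r0; rewrite /halfspace/= => q1 q2 r0.
  by rewrite ifT; [rewrite lee_fin; lra|apply/eqP; lra].
split.
- rewrite /closed_fun epiE; apply: closedI; last apply: closedI;
    exact: closed_halfspace.
- split=> [q|]; first by rewrite /unit_demand; case: ifP.
  by exists (const_mx (-1)%R); rewrite /unit_demand mxE eqxx.
- rewrite /convex_fun epiE; apply: convex_setI; last apply: convex_setI;
    exact: convex_halfspace.
Qed.

Lemma valid_kinked_market : valid_market kinked_market.
Proof.
split.
- by case: closed_proper_convex_recourse.
- move=> t p q _ _ /=.
  have t0 : (0 <= t%:num)%R by [].
  have t1 : (t%:num <= 1)%R by [].
  (* Both affine minorants at both points; averaging them bounds each branch of the maximum at the
     convex combination. *)
  have : (0 <= kinked_cost p)%R by rewrite le_max lexx.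
  have : (0 <= kinked_cost q)%R by rewrite le_max lexx.
  have : (p 0 0 - 1 <= kinked_cost p)%R by rewrite le_max lexx orbT.
  have : (q 0 0 - 1 <= kinked_cost q)%R by rewrite le_max lexx orbT.
  rewrite convRE [kinked_cost (conv t p q)]/kinked_cost ge_max !mxE /unstable.onem.
  move: (t%:num%R) t0 t1 => {}t t0 t1 *.
  by apply/andP; split; nra.
- move=> p q _ _ /(_ 0%R) pq /=.
  by rewrite /kinked_cost ge_max !le_max lexx/= lerB// orbT.
- by move=> m; exact: closed_proper_convex_demand.
Qed.

Lemma valid_kinked_bid (e : bid kinked_market) : valid_bid e.
Proof.
split=> /=; rewrite ?invr_ge0//; last by exists 0%R; rewrite mxE oner_neq0.
by rewrite nonnegv1 mxE.
Qed.

Lemma big_kinked (T : Type) (x0 : T) (op : Monoid.com_law x0)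
    (F : agent no_bids -> T) :
  \big[op/x0]_i F i = op (F None) (F firm).
Proof.
rewrite (bigD1 None)//= (bigD1 firm)//= big_pred0 ?Monoid.mulm1//.
by move=> [[[]|[f]]|].
Qed.

Lemma total_cost_kinked (q : agent no_bids -> 'rV[R]_1) :
  total_cost q = recourse_cost kinked_market (q None) + unit_demand (q firm).
Proof. by rewrite /total_cost big_kinked. Qed.

(** Recourse supplies [x] and the firm takes its unit; balanced at [x = 1], where the kink lies. *)
Definition kinked_profile x (i : agent no_bids) : 'rV[R]_1 :=
  const_mx (if i is None then x else -1)%R.

Lemma total_cost_profile x : (0 <= x)%R ->
  total_cost (kinked_profile x) = (Num.max 0 (x - 1)%R)%:E.
Proof.
move=> x0; rewrite total_cost_kinked recourse_cost_kinked /unit_demand.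
by rewrite /kinked_cost !mxE x0 eqxx adde0.
Qed.

Lemma sum_profile x : (\sum_i kinked_profile x i = const_mx (x - 1))%R.
Proof. by rewrite big_kinked; apply/rowP => k; rewrite !mxE. Qed.

Lemma perturbed_value_kinked t : (0 <= t <= 1)%R ->
  perturbed_value no_bids (t *: const_mx 1%R)%R = 0.
Proof.
move=> /andP[t0 t1]; apply/eqP; rewrite eq_le; apply/andP; split; last first.
  by apply/ereal_infP => _ [q _ <-]; exact: kinked_total_ge0.
(* With [t] units supplied from outside, recourse covers the remaining [1 - t] in its free range. *)
apply: ereal_inf_lbound; exists (kinked_profile (1 - t)) => /=.
  by rewrite sum_profile; apply/rowP => k; rewrite !mxE; lra.
rewrite total_cost_profile ?subr_ge0//; congr EFin; apply/max_idPl; lra.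
Qed.

Lemma exchange_value_kinked : exchange_value no_bids = 0.
Proof.
by rewrite -perturbed_value0 -(scale0r (const_mx 1%R)) perturbed_value_kinked
  ?lexx ?ler01.
Qed.

(** On feasible injections the Lagrangian is [max(0, q - 1) - x (q - 1)], with [q] the recourse
    supply. It is nonnegative because [x] lies between the slopes 0 and 1 of the kink. *)
Lemma saddle_point_kinked x : (0 <= x <= 1)%R ->
  saddle_point (kinked_profile 1%R) (const_mx (- x)%R).
Proof.
move=> /andP[x0 x1].
have L0 y : Lagrangian (kinked_profile 1%R) y = 0.
  by rewrite /Lagrangian total_cost_profile// sum_profile dot1 !mxE subrr maxxx mulr0 adde0.
split=> [y|q]; rewrite !L0// /Lagrangian total_cost_kinked recourse_cost_kinked big_kinked.
rewrite /unit_demand dot1 !mxE.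
case: ifPn => q0; case: eqP => q1; rewrite ?adde0 ?addey// ?addye// ?leey//.
rewrite -EFinD lee_fin q1.
rewrite /kinked_cost; case: (leP 0 (q None 0 0 - 1))%R => ?; nra.
Qed.

Lemma shadow_prices_kinked x : (0 <= x <= 1)%R ->
  shadow_prices no_bids (const_mx x).
Proof.
move=> x01; exists (const_mx (- x)%R); first exists (kinked_profile 1%R).
  exact: saddle_point_kinked.
by apply/rowP => k; rewrite !mxE opprK.
Qed.

(* A negative price would reward withdrawing the unit of recourse supply. *)
Lemma shadow_prices_kinked_ge0 l : shadow_prices no_bids l -> (0 <= l 0 0)%R.
Proof.
move=> [y [q [qy yq]] <-].
have : 0 <= Lagrangian (kinked_profile 0%R) y.
  apply: le_trans (yq _); apply: le_trans (qy 0%R).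
  by rewrite /Lagrangian dot1 mxE mul0r adde0 kinked_total_ge0.
rewrite /Lagrangian total_cost_profile// sum_profile dot1 !mxE -EFinD lee_fin.
by rewrite max_l; lra.
Qed.

(** The infimum is attained at the price 0. *)
Lemma min_price_kinked : min_price (shadow_prices no_bids) (const_mx 1%R) = 0.
Proof.
apply/eqP; rewrite eq_le; apply/andP; split.
  apply: ereal_inf_lbound; exists (const_mx 0%R); last by rewrite dot1 !mxE mul0r.
  by apply: shadow_prices_kinked; rewrite lexx ler01.
apply/ereal_infP => _ [l /shadow_prices_kinked_ge0 l0 <-].
by rewrite dot1 mxE mulr1 lee_fin.
Qed.

(** The quotient is constantly 0 for [0 < t <= 1]. *)
Lemma cvg_diff_quotient_kinked :
  diff_quotient (perturbed_value no_bids) (const_mx 1%R) t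
    @[t --> (0%R : R)^'+] --> (0 : \bar R).
Proof.
apply: cvg_near_cst; near=> t.
rewrite /diff_quotient perturbed_value0 exchange_value_kinked perturbed_value_kinked.
  by rewrite subee// mul0e.
by apply/andP; split; near: t; [exact: nbhs_right_ge|exact: nbhs_right_le].
Unshelve. all: by end_near.
Qed.

Lemma dirderiv0_kinked : dirderiv0 (perturbed_value no_bids) (const_mx 1%R) = 0.
Proof. by apply: cvg_lim => //; exact: cvg_diff_quotient_kinked. Qed.

Lemma regular_kinked : regular no_bids.
Proof.
split.
- case=> [[m|[f]]|]//; first exact: closed_proper_convex_demand.
  exact: closed_proper_convex_recourse.
- exists (kinked_profile 1%R); last by rewrite total_cost_profile// ltry.
  by rewrite sum_profile subrr; apply/rowP => k; rewrite !mxE.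
- by rewrite exchange_value_kinked.
- exists (kinked_profile 1%R), (const_mx (- 0)%R); apply: saddle_point_kinked.
  by rewrite lexx ler01.
Qed.

End KinkedMarket.

Theorem propositionS3p1 (R : realType) :
  (forall (n : nat) (M : market R n) (S : {fset bid M}) (e : bid M),
    standing_assumptions S e ->
    [/\ exchange_value (e |` S)%fset =
          ereal_inf [set (bid_rate e * x)%:E + perturbed_value S (x *: bid_inj e)%R
                    | x in [set x : R | (0 <= x <= bid_limit e)%R]],
        ereal_inf [set (bid_rate e * x)%:E + perturbed_value S (x *: bid_inj e)%R
                  | x in [set x : R | (0 <= x <= bid_limit e)%R]] <=
           perturbed_value S 0%R
      & perturbed_value S 0%R = exchange_value S] /\
    ((0 < bid_limit e)%R -> finite_dirderiv0 (perturbed_value S) (bid_inj e) ->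
      ((bid_rate e)%:E + dirderiv0 (perturbed_value S) (bid_inj e) < 0 ->
         exchange_value (e |` S)%fset < exchange_value S) /\
      (dirderiv0 (perturbed_value S) (bid_inj e) =
          - min_price (shadow_prices S) (bid_inj e) ->
         ((bid_rate e)%:E + dirderiv0 (perturbed_value S) (bid_inj e) < 0 <->
          (bid_rate e)%:E - min_price (shadow_prices S) (bid_inj e) < 0))) /\
    (forall l : 'rV[R]_n, shadow_prices S = [set l] ->
      ((bid_rate e)%:E - min_price (shadow_prices S) (bid_inj e) < 0 <->
       (bid_rate e - dot l (bid_inj e) < 0)%R))) /\
  (exists (n : nat) (M : market R n) (S : {fset bid M}) (e : bid M),
    [/\ standing_assumptions S e,
        finite_dirderiv0 (perturbed_value S) (bid_inj e),
        dirderiv0 (perturbed_value S) (bid_inj e) =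
          - min_price (shadow_prices S) (bid_inj e),
        ~ (exists l : 'rV[R]_n, shadow_prices S = [set l])
      & (exists2 l : 'rV[R]_n, shadow_prices S l &
           (bid_rate e - dot l (bid_inj e) < 0)%R) /\
        exchange_value (e |` S)%fset = exchange_value S]).
Proof.
split=> [n M S e [_ _ [Sreg _ Qfin _] ve eS]|].
  have Sp (i : agent S) : proper_fun (cost i) by have [] := Sreg i.
  have QE := exchange_value_fsetU1 Sp ve eS.
  split; [split=> //|split].
  (* Zero uptake is always allowed and leaves the other agents unperturbed. *)
  - apply: ereal_inf_lbound; exists 0%R; last by rewrite mulr0 add0e scale0r.
    by rewrite /= lexx ltW//; case: ve.
  - exact: perturbed_value0.
  (* Substituting the support identity turns one condition literally into the other. *)
  - move=> x0 Vfin; split=> [cV|->//].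
    have V0 : perturbed_value S 0%R \is a fin_num by rewrite perturbed_value0.
    have [t tx Vt] := dirderiv0_lt x0 V0 Vfin cV.
    rewrite -(perturbed_value0 S) QE; apply: le_lt_trans Vt.
    by apply: ereal_inf_lbound; exists t.
  - by move=> l ->; rewrite /min_price image_set1 ereal_inf1 -EFinB lte_fin.
pose S : {fset bid (@kinked_market R)} := fset0.
exists 1%N, kinked_market, S, tt; split.
- split=> //; [exact: valid_kinked_market|exact: regular_kinked|exact: valid_kinked_bid].
- split; last by rewrite dirderiv0_kinked.
  by apply/cvg_ex; exists 0; exact: cvg_diff_quotient_kinked.
- by rewrite dirderiv0_kinked min_price_kinked oppe0.
(* The prices 0 and 1 would both equal [l]. *)
- move=> [l Sl].
  have price x : (0 <= x <= 1)%R -> const_mx x = l.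
    by move=> x01; have := shadow_prices_kinked x01; rewrite -/S Sl.
  have /rowP/(_ 0%R) : const_mx 0%R = const_mx 1%R :> 'rV[R]_1.
    by rewrite !price ?lexx ?ler01.
  by rewrite !mxE => /esym/eqP; rewrite oner_eq0.
- split.
    (* At price 1 the reduced cost is [1/2 - 1 < 0]. *)
    exists (const_mx 1%R); first by apply: shadow_prices_kinked; rewrite lexx ler01.
    by rewrite dot1 !mxE /=; lra.
  rewrite exchange_value_kinked; apply/eqP; rewrite eq_le; apply/andP; split; last first.
    by apply/ereal_infP => _ [q _ <-]; exact: kinked_total_ge0.
  rewrite (exchange_value_fsetU1 _ (valid_kinked_bid tt)) ?inE//; last first.
    by move=> i; have [/(_ i)[]] := @regular_kinked R.
  (* Zero uptake already reaches the lower bound 0. *)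
  apply: ereal_inf_lbound; exists 0%R; first by rewrite /= lexx ler01.
  by rewrite mulr0 add0e perturbed_value_kinked ?lexx ?ler01.
Qed.
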